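(* Let $X$ be a real Hilbert space and let $T_1,T_2,T_3\colon X\to X$ be $\sigma_1$-, $\sigma_2$-, and $\sigma_3$-cocoercive, respectively. Let $\eta,\nu,\lambda,\delta>0$, set $S:=-\nu\mathrm{Id}+\lambda T_1-\delta T_3T_1$ and $T:=\mathrm{Id}-\eta T_1+\eta T_2S$. Suppose $\operatorname{Fix}T\neq\varnothing$ and that either (a) $\lambda=2\nu\sigma_1=2\sigma_2$ and $\eta<\eta^*:=\frac{1}{\nu}\big(\lambda-\frac{\delta}{2\sigma_3}\big)$; or (b) $\lambda<\nu\sigma_1+\sigma_2$ and $\eta<\eta^*:=\frac1\nu\Big(\frac{(2\nu\sigma_1-\lambda)(2\sigma_2-\lambda)}{2(\nu\sigma_1+\sigma_2-\lambda)}+\lambda-\frac{\delta}{2\sigma_3}\Big)$. Let $x_0\in X$ and $x_{n+1}:=Tx_n$ for all $n\in\mathbb N$. Then: (i) $T$ is $\frac{\eta}{\eta^*}$-averaged; $(x_n)$ converges weakly to some $x^*\in\operatorname{Fix}T$, and $\|x_n-Tx_n\|=o(1/\sqrt n)$ as $n\to\infty$. (ii) $(T_3T_1x_n)$ converges strongly to $T_3T_1x^*$, and $T_3T_1(\operatorname{Fix}T)=\{T_3T_1x^*\}$. (iii) If (a) holds and $\nu=\lambda-1$, then $(T_1x_n)$ and $(T_2Sx_n)$ converge weakly to $T_1x^*=T_2Sx^*$. (iv) If (b) holds, then $(T_1x_n)$ and $(T_2Sx_n)$ converge strongly to $T_1x^*=T_2Sx^*$, and $T_1(\operatorname{Fi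x}T)=T_2S(\operatorname{Fix}T)=\{T_1x^*\}$.
   Context: An operator $T\colon X\to X$ is $\sigma$-cocoercive ($\sigma>0$) if $\langle x-y,Tx-Ty\rangle\ge\sigma\|Tx-Ty\|^2$ for all $x,y$. $T$ is $\theta$-averaged for $\theta\in(0,1)$ if $T=(1-\theta)\mathrm{Id}+\theta N$ with $N$ nonexpansive. $\operatorname{Fix}T=\{x:Tx=x\}$. *)

(* Defs.v *)
From HB Require Import structures.
From mathcomp Require Import all_boot all_order all_algebra.
From mathcomp Require Import all_classical all_reals all_analysis.
Set Implicit Arguments. Unset Strict Implicit. Unset Printing Implicit Defensive.
Import Order.TTheory GRing.Theory Num.Theory.
Import numFieldNormedType.Exports.
Local Open Scope classical_set_scope.
Local Open Scope ring_scope.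

(* A real Hilbert space: a complete normed space over R whose norm is
   induced by a (symmetric, bilinear) inner product ip. *)
Definition is_inner_product (R : realType) (V : normedModType R)
  (ip : V -> V -> R) : Prop :=
  [/\ forall x y, ip x y = ip y x,
      forall (a : R) x y z, ip (a *: x + y) z = a * ip x z + ip y z &
      forall x, ip x x = `|x| ^+ 2].

Definition cocoercive (R : realType) (V : normedModType R)
  (ip : V -> V -> R) (sigma : R) (T : V -> V) : Prop :=
  forall x y, sigma * `|T x - T y| ^+ 2 <= ip (x - y) (T x - T y).

Definition nonexpansive (R : realType) (V : normedModType R) (N : V -> V) : Prop :=
  forall x y, `|N x - N y| <= `|x - y|.

Definition averaged (R : realType) (V : normedModType R) (theta : R) (T : V -> V) : Prop :=
  0 < theta < 1 /\
  exists N : V -> V, nonexpansive N /\ forall x, T x = (1 - theta) *: x + theta *: N x.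

Definition Fix (T0 : Type) (T : T0 -> T0) : set T0 := [set x | T x = x].

Definition weak_cvg (R : realType) (V : normedModType R)
  (ip : V -> V -> R) (u : nat -> V) (l : V) : Prop :=
  forall y, (fun n => ip (u n) y) @ \oo --> ip l y.

(* Main.v *)
(* Write d, a, b, c for the differences over a pair of points of Id, T1, T2 S
   and T3 T1.  Combining the three cocoercivity inequalities and completing
   squares gives
     nu <d, a - b> >= (nu eta*/2) |a - b|^2 + delta s3 |c - (a - b)/(2 s3)|^2,
   with an additional multiple of |(nu s1 - lam/2) a + (s2 - lam/2) b|^2 in
   case (b).  The first term says that T is averaged; the other terms tend to 0
   along the iterates, because a - b = (x_n - T x_n)/eta does, and this yields
   the strong limits.

   Weak convergence of the iterates is obtained without weak compactness: a
   bounded sequence has a unique asymptotic center (minimizer of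
   limsup |x_n - z|), which is a fixed point as soon as x_n - T x_n -> 0.  If
   <x_n - z, w> stayed above some e > 0 along a subsequence, z + t w would beat
   z, hence every fixed point, as asymptotic center of that subsequence.

   For (iii), test the cocoercivity of T2 at the pair S x_n, S z + t w.  In case
   (a) all quadratic terms cancel up to a - b, leaving
     t <b, w> <= t^2 |w|^2 / s2 + o(1);
   divide by t and let t -> 0. *)
Require Import Defs.
From HB Require Import structures.
From mathcomp Require Import all_boot all_order all_algebra.
From mathcomp Require Import all_classical all_reals all_analysis.
From mathcomp Require Import ring lra.
Set Implicit Arguments. Unset Strict Implicit. Unset Printing Implicit Defensive.
Import Order.TTheory GRing.Theory Num.Theory.
Import numFieldNormedType.Exports.
Local Open Scope classical_set_scope.
Local Open Scope ring_scope.

(** * Bilinear calculus and Cauchy-Schwarz *)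

Section InnerProduct.
Context {R : realType} {V : normedModType R} {ip : V -> V -> R}.
Hypothesis Hip : is_inner_product ip.

Lemma ipC x y : ip x y = ip y x.
Proof. by have [h _ _] := Hip. Qed.

Lemma ipxx x : ip x x = `|x| ^+ 2.
Proof. by have [_ _ h] := Hip. Qed.

Lemma ipDl x y z : ip (x + y) z = ip x z + ip y z.
Proof. by have [_ h _] := Hip; rewrite -{1}(scale1r x) h mul1r. Qed.

Lemma ip0l z : ip 0 z = 0.
Proof. by have := ipDl 0 0 z; rewrite addr0 => h; lra. Qed.

Lemma ip0r z : ip z 0 = 0.
Proof. by rewrite ipC ip0l. Qed.

Lemma ipZl a x z : ip (a *: x) z = a * ip x z.
Proof. by have [_ h _] := Hip; rewrite -(addr0 (a *: x)) h ip0l addr0. Qed.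

Lemma ipNl x z : ip (- x) z = - ip x z.
Proof. by rewrite -scaleN1r ipZl mulN1r. Qed.

Lemma ipDr x y z : ip z (x + y) = ip z x + ip z y.
Proof. by rewrite ipC ipDl !(ipC z). Qed.

Lemma ipZr a x z : ip z (a *: x) = a * ip z x.
Proof. by rewrite ipC ipZl (ipC z). Qed.

Lemma ipNr x z : ip z (- x) = - ip z x.
Proof. by rewrite ipC ipNl (ipC z). Qed.

Definition ipE := (ipDl, ipDr, ipNl, ipNr, ipZl, ipZr).

(** Cauchy-Schwarz is read off from the triangle inequality of the norm, squared and expanded. *)
Lemma ip_le_norm x y : ip x y <= `|x| * `|y|.
Proof.
have h : `|x + y| ^+ 2 <= (`|x| + `|y|) ^+ 2.
  by rewrite ler_pXn2r ?nnegrE ?addr_ge0 ?normr_ge0 // ler_normD.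
move: h; rewrite -ipxx !ipE !ipxx (ipC y x) sqrrD; lra.
Qed.

Lemma norm_ip_le x y : `|ip x y| <= `|x| * `|y|.
Proof.
rewrite ler_norml ip_le_norm andbT lerNl -ipNl -(normrN x).
exact: ip_le_norm.
Qed.

Lemma norm_le_of_cocoercive (s : R) d a : s * `|a| ^+ 2 <= ip d a -> s * `|a| <= `|d|.
Proof.
move=> h; have [->|a0] := eqVneq `|a| 0; first by rewrite mulr0.
have ap : 0 < `|a| by rewrite lt_neqAle eq_sym a0 normr_ge0.
by rewrite -(ler_pM2r ap) -mulrA -expr2 (le_trans h) // ip_le_norm.
Qed.

End InnerProduct.

(** * Asymptotic centers along a proper filter *)

Section AsymptoticCenter.
Context {R : realType} {V : completeNormedModType R} {ip : V -> V -> R}.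
Hypothesis Hip : is_inner_product ip.
Context {I : Type} {F : set_system I} {FF : ProperFilter F} {v : I -> V}.

(** The clauses encode that the limsup of [|v n - z|] along [F] is at most [m], and that no [w] has
    a limsup below [m]. Eventual bounds make sense for any filter, so a subsequence can be treated
    as [within A \oo]. *)
Definition asymptotic_center (m : R) (z : V) :=
  (forall e, 0 < e -> \forall n \near F, `|v n - z| <= m + e) /\
  (forall w s, (\forall n \near F, `|v n - w| <= s) -> m <= s).

(* By the parallelogram law, the midpoint of two nearly optimal points that
   are far apart would be better than optimal. *)
Lemma near_centers_dist (m r : R) (z w : V) : 0 <= m ->
  (forall w s, (\forall n \near F, `|v n - w| <= s) -> m <= s) ->
  (\forall n \near F, `|v n - z| <= r) -> (\forall n \near F, `|v n - w| <= r) ->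
  `|z - w| ^+ 2 <= 4 * (r ^+ 2 - m ^+ 2).
Proof.
move=> m0 mmin hz hw.
have r0 : 0 <= r by exact: le_trans m0 (mmin _ _ hz).
pose s := r ^+ 2 - `|z - w| ^+ 2 / 4.
have hs : \forall n \near F, `|v n - 2^-1 *: (z + w)| ^+ 2 <= s.
  near=> n.
  have h1 : `|v n - z| ^+ 2 <= r ^+ 2.
    by rewrite ler_pXn2r ?nnegrE //; near: n.
  have h2 : `|v n - w| ^+ 2 <= r ^+ 2.
    by rewrite ler_pXn2r ?nnegrE //; near: n.
  have -> : `|v n - 2^-1 *: (z + w)| ^+ 2 =
      (`|v n - z| ^+ 2 + `|v n - w| ^+ 2) / 2 - `|z - w| ^+ 2 / 4.
    rewrite -!(ipxx Hip) !(ipE Hip) (ipC Hip z (v n)) (ipC Hip w (v n)).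
    by rewrite (ipC Hip w z); field.
  rewrite /s; lra.
have s0 : 0 <= s by have [n] := filter_ex hs; apply: le_trans; exact: exprn_ge0.
have : m <= Num.sqrt s.
  apply: (mmin (2^-1 *: (z + w))); near=> n.
  rewrite -(ger0_norm (normr_ge0 _)) -sqrtr_sqr ler_wsqrtr //.
  by near: n.
rewrite -(@ler_pXn2r _ 2) ?nnegrE ?sqrtr_ge0 // sqr_sqrtr // /s; lra.
Unshelve. all: by end_near. Qed.

Lemma asymptotic_center_unique m z w : 0 <= m ->
  asymptotic_center m z ->
  (forall e, 0 < e -> \forall n \near F, `|v n - w| <= m + e) -> w = z.
Proof.
move=> m0 [hz mmin] hw; apply/eqP; rewrite -subr_eq0 -normr_le0.
apply/ler_addgt0Pr => e e0; rewrite add0r.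
(* With [r = m + d] and [d <= 1], [4 (r^2 - m^2) <= 4 d (2 m + 1)], and this [d] keeps the right
   side at most [e^2]. *)
pose d := Num.min 1 (e ^+ 2 / (4 * (2 * m + 1))).
have k0 : 0 < 4 * (2 * m + 1) by lra.
have d0 : 0 < d by rewrite lt_min ltr01 /= divr_gt0 ?exprn_gt0.
have d1 : d <= 1 by rewrite ge_min lexx.
have d2 : d * (4 * (2 * m + 1)) <= e ^+ 2.
  by rewrite -ler_pdivlMr // ge_min lexx orbT.
rewrite -(@ler_pXn2r _ 2) ?nnegrE ?(ltW e0) //.
have h := near_centers_dist m0 mmin (hw _ d0) (hz _ d0).
by apply: le_trans h (le_trans _ d2); nra.
Qed.

(** The infimum of the eventual radii is approached by centers [u k]; [near_centers_dist] makes them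
    Cauchy, and their limit attains the infimum. *)
Lemma asymptotic_center_exists (r : R) :
  (\forall n \near F, `|v n| <= r) ->
  exists m z, 0 <= m /\ asymptotic_center m z.
Proof.
move=> bv.
pose E := [set s : R | exists w, \forall n \near F, `|v n - w| <= s].
have E0 : lbound E 0.
  by move=> s [w hw]; have [n] := filter_ex hw; apply: le_trans.
have En : E !=set0.
  by exists r, 0; near=> n; rewrite subr0; near: n.
have Einf : has_inf E by split=> //; exists 0.
have m0 : 0 <= inf E by exact: lb_le_inf.
have mmin w s : (\forall n \near F, `|v n - w| <= s) -> inf E <= s.
  by move=> h; apply: ge_inf; [exists 0 | exists w].
have /choice[u hu] : forall k : nat, exists w,
    \forall n \near F, `|v n - w| <= inf E + k.+1%:R^-1.
  move=> k; have [|s [w hw] hs] := @inf_adherent _ E k.+1%:R^-1 _ Einf.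
    by rewrite invr_gt0 ltr0Sn.
  by exists w; apply: filterS hw => n /le_trans; apply; exact: ltW.
have hu' e : 0 < e -> \forall k \near \oo, \forall n \near F, `|v n - u k| <= inf E + e.
  move=> e0; near=> k; apply: filterS (hu k) => n /le_trans; apply.
  by rewrite lerD2l; apply/ltW; near: k; exact: near_infty_natSinv_lt (PosNum e0).
have cu : cauchy (u @ \oo).
  apply: cauchy_exP => e e0.
  (* The factor 8 in place of 4 bounds the squared distance by [e^2 / 2], which gives the strict
     inequality of an open ball. *)
  pose d := Num.min 1 (e ^+ 2 / (8 * (2 * inf E + 1))).
  have k0 : 0 < 8 * (2 * inf E + 1) by lra.
  have d0 : 0 < d by rewrite lt_min ltr01 /= divr_gt0 ?exprn_gt0.
  have d1 : d <= 1 by rewrite ge_min lexx.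
  have d2 : d * (8 * (2 * inf E + 1)) <= e ^+ 2.
    by rewrite -ler_pdivlMr // ge_min lexx orbT.
  have [K hK] := filter_ex (hu' _ d0).
  exists (u K); rewrite -ball_normE.
  change (\forall k \near \oo, `|u K - u k| < e); near=> k.
  have hk : \forall n \near F, `|v n - u k| <= inf E + d by near: k; exact: hu'.
  rewrite -(@ltr_pXn2r _ 2) ?nnegrE ?(ltW e0) //.
  apply: le_lt_trans (near_centers_dist m0 mmin hK hk) _.
  have : 0 < e ^+ 2 by rewrite exprn_gt0.
  by nra.
have /cauchy_cvgP/cvg_ex[z /cvgrPdist_le uz] := cu.
exists (inf E), z; split=> //; split=> // e e0.
have e20 : 0 < e / 2 by lra.
have [k [hk1 hk2]] := filter_ex (filterI (uz _ e20) (hu' _ e20)).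
apply: filterS hk2 => n hn.
have := ler_normB (v n - u k) (z - u k); rewrite opprB addrA subrK => h.
by move: hk1 => /=; lra.
Unshelve. all: by end_near. Qed.

End AsymptoticCenter.

(** Since [|v n - T z| <= |v n - T (v n)| + |v n - z|], the point [T z] is asymptotically as good as
    [z], and uniqueness applies. *)
Lemma asymptotic_center_fixpoint (R : realType) (V : completeNormedModType R)
  (ip : V -> V -> R) (Hip : is_inner_product ip) (I : Type) (F : set_system I)
  (FF : ProperFilter F) (v : I -> V) (T : V -> V) (m : R) (z : V) :
  nonexpansive T -> (fun n => `|v n - T (v n)|) @ F --> (0 : R) ->
  0 <= m -> asymptotic_center (F := F) (v := v) m z -> T z = z.
Proof.
move=> Tn /cvgrPdist_le vT m0 hz.
apply: (asymptotic_center_unique Hip m0 hz) => e e0.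
have e20 : 0 < e / 2 by lra.
near=> n.
have h1 : `|v n - z| <= m + e / 2 by near: n; exact: hz.1.
have h2 : `|v n - T (v n)| <= e / 2.
  near: n; apply: filterS (vT _ e20) => n.
  by rewrite sub0r normrN normr_id.
have := ler_normD (v n - T (v n)) (T (v n) - T z); rewrite addrA subrK.
by have := Tn (v n) z; lra.
Unshelve. all: by end_near. Qed.

(** * Krasnoselskii-Mann iteration: residual rate and weak convergence *)

Section KrasnoselskiiMann.
Context {R : realType} {V : completeNormedModType R} {ip : V -> V -> R}.
Hypothesis Hip : is_inner_product ip.
Context {T : V -> V} {k : R}.
Hypothesis k0 : 0 < k.
(** Averagedness in residual form, with [k = 1/theta - 1]. *)
Hypothesis HT : forall x y,
  `|T x - T y| ^+ 2 + k * `|(x - T x) - (y - T y)| ^+ 2 <= `|x - y| ^+ 2.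
Context {x0 : V}.
Let x n := iter n T x0.

Lemma km_nonexpansive : nonexpansive T.
Proof.
move=> a b; rewrite -(@ler_pXn2r _ 2) ?nnegrE //.
by apply: le_trans (HT a b); rewrite lerDl mulr_ge0 ?sqr_ge0 // ltW.
Qed.

Lemma km_fejer z n m : Fix T z -> (n <= m)%N -> `|x m - z| <= `|x n - z|.
Proof.
move=> Tz /subnK <-; elim: (m - n)%N => [//|i IH].
by apply: le_trans IH; rewrite addSn -{1}Tz; exact: km_nonexpansive.
Qed.

Lemma km_residual_decr n m : (n <= m)%N ->
  `|x m - T (x m)| <= `|x n - T (x n)|.
Proof.
move=> /subnK <-; elim: (m - n)%N => [//|i IH].
by apply: le_trans IH; rewrite addSn; exact: km_nonexpansive.
Qed.

Lemma km_dist_cvg z : Fix T z -> cvgn (fun n => `|x n - z|).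
Proof.
move=> Tz; apply: nonincreasing_is_cvgn; first by move=> n m; exact: km_fejer.
by exists 0 => _ [n _ <-].
Qed.

(** [HT] at the iterates and [z] telescopes; residuals decrease, so each of the [j] summands can be
    replaced by the residual at [n + j]. *)
Lemma km_residual_sum z n j : Fix T z ->
  `|x (n + j)%N - z| ^+ 2 + k * `|x (n + j)%N - T (x (n + j)%N)| ^+ 2 *+ j
  <= `|x n - z| ^+ 2.
Proof.
move=> Tz; elim: j => [|j IH]; first by rewrite addn0 mulr0n addr0.
apply: le_trans IH; rewrite addnS.
have := HT (x (n + j)%N) z; rewrite Tz subrr subr0 => h.
have d : `|x (n + j).+1 - T (x (n + j).+1)| ^+ 2
    <= `|x (n + j)%N - T (x (n + j)%N)| ^+ 2.
  by rewrite ler_pXn2r ?nnegrE // km_residual_decr.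
have hj : k * `|x (n + j).+1 - T (x (n + j).+1)| ^+ 2 *+ j.+1
   <= k * `|x (n + j)%N - T (x (n + j)%N)| ^+ 2 *+ j.+1.
  by rewrite ler_wMn2r // ler_pM2l.
apply: le_trans (lerD (lexx _) hj) _; rewrite mulrS addrA lerD2r.
exact: h.
Qed.

(** Summing only from [M] to [n], where the squared distances to [z] are almost constant, improves
    big O to little o. *)
Lemma km_rate : Fix T !=set0 ->
  (fun n : nat => Num.sqrt (n%:R : R) * `|x n - T (x n)|) @ \oo --> (0 : R).
Proof.
move=> [z Tz]; apply/cvgrPdist_le => e e0.
pose D n : R := `|x n - z| ^+ 2.
have dD n m : (n <= m)%N -> D m <= D n.
  by move=> nm; rewrite ler_pXn2r ?nnegrE // km_fejer.
have cD : cvgn D.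
  apply: nonincreasing_is_cvgn => //.
  by exists 0 => _ [n _ <-]; exact: sqr_ge0.
have D_ge := nonincreasing_cvgn_ge dD cD.
(* The half pays for [n <= 2 (n - M)], valid once [n >= 2 M]. *)
have d0 : 0 < k * e ^+ 2 / 2 by rewrite divr_gt0 // mulr_gt0 // exprn_gt0.
have /cvgrPdist_le/(_ _ d0)/filter_ex[M hM] := cD.
near=> n.
have nM : (M.*2 <= n)%N by near: n; exact: nbhs_infty_ge.
have Mn : (M <= n)%N by rewrite (leq_trans _ nM) // -addnn leq_addr.
rewrite sub0r normrN ger0_norm ?mulr_ge0 ?sqrtr_ge0 //.
rewrite -(@ler_pXn2r _ 2) ?nnegrE ?mulr_ge0 ?sqrtr_ge0 ?(ltW e0) //.
rewrite exprMn sqr_sqrtr //.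
have := km_residual_sum M (n - M) Tz; rewrite subnKC //.
set r : R := `|_ - T _| ^+ 2; have r0 : 0 <= r by exact: sqr_ge0.
rewrite -/(D n) -/(D M) -mulr_natr => h.
have hn : n%:R <= (n - M)%:R * 2 :> R.
  rewrite -natrM ler_nat mulnBl !muln2 leq_subRL ?leq_double //.
  by rewrite -[n.*2]addnn leq_add2r.
move: hM; rewrite distrC ger0_norm ?subr_ge0 ?D_ge // => hM; have hDn := D_ge n.
have : k * r * (n - M)%:R <= k * e ^+ 2 / 2 by lra.
rewrite -mulrA -[k * e ^+ 2 / 2]mulrA ler_pM2l // => h2.
have : n%:R * r <= (n - M)%:R * 2 * r by rewrite ler_wpM2r.
lra.
Unshelve. all: by end_near. Qed.

Lemma km_residual_cvg0 : Fix T !=set0 ->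
  (fun n => `|x n - T (x n)|) @ \oo --> (0 : R).
Proof.
move=> /km_rate h; apply: (squeeze_cvgr _ (cvg_cst _) h); near=> n.
rewrite normr_ge0 /= ler_peMl // -[leLHS]sqrtr1 ler_wsqrtr // ler1n.
by near: n; exact: nbhs_infty_gt.
Unshelve. all: by end_near. Qed.

Theorem km_weak_cvg : Fix T !=set0 -> exists z, Fix T z /\ weak_cvg ip x z.
Proof.
move=> FT; have [p Tp] := FT; have r0 := km_residual_cvg0 FT.
have bx : \forall n \near \oo, `|x n| <= `|x0 - p| + `|p|.
  near=> n; have := ler_normD (x n - p) p; rewrite subrK => /le_trans; apply.
  by rewrite lerD2r; exact: km_fejer Tp (leq0n n).
have [m [z [m0 hz]]] := asymptotic_center_exists Hip bx.
have Tz : Fix T z.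
  exact: (asymptotic_center_fixpoint Hip _ km_nonexpansive r0 m0 hz).
exists z; split=> //.
(* An upper bound used at both [w] and [- w] is two-sided. *)
suff main w e : 0 < e -> \forall n \near \oo, ip (x n - z) w <= e.
  move=> w; apply/cvgrPdist_le => e e0; near=> n.
  have h1 : ip (x n - z) w <= e by near: n; exact: main.
  have h2 : ip (x n - z) (- w) <= e by near: n; exact: main.
  by move: h1 h2; rewrite !(ipE Hip) ler_norml; lra.
move=> e0; apply: contrapT => nA.
(* Failure of the eventual bound is what makes [within A \oo] proper; it plays the role of a
   subsequence. *)
pose A := [set n | e < ip (x n - z) w].
have FA : ProperFilter (within A \oo).
  apply: Build_ProperFilter => hA; apply: nA.
  have {}hA : \forall n \near \oo, e < ip (x n - z) w -> False := hA.
  by apply: filterS hA => n h; rewrite leNgt; apply/negP => /h.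
have sub : within A \oo --> \oo by exact: cvg_within.
have [m' [z' [m'0 hz']]] := asymptotic_center_exists Hip (sub _ bx).
have Tz' : Fix T z'.
  apply: (asymptotic_center_fixpoint Hip _ km_nonexpansive _ m'0 hz').
  exact: cvg_trans (cvg_app _ sub) r0.
(* By Fejer monotonicity [|x n - z'|] converges, so its limit along [A] is its limit along the whole
   sequence, hence at least [m]. *)
have mm' : m <= m'.
  have cz' := km_dist_cvg Tz'.
  have hl := nonincreasing_cvgn_ge (fun n m => km_fejer Tz' (n:=n) (m:=m)) cz'.
  apply/ler_addgt0Pr => d d0; have d20 : 0 < d / 2 by lra.
  have [n hn] := filter_ex (hz'.1 _ d20).
  have : m <= limn (fun n => `|x n - z'|) + d / 2.
    apply: (hz.2 z'); have /cvgrPdist_le/(_ _ d20) := cz'.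
    by apply: filterS => i; rewrite ler_norml; lra.
  by have := hl n; lra.
(* As [t (|w|^2 + 1) = e], moving from [z] to [z + t w] lowers the squared distance by more than
   [t e] on [A]; the [d] below spends at most half of this gain. *)
pose t := e / (`|w| ^+ 2 + 1).
have w1 : 0 < `|w| ^+ 2 + 1 by have := sqr_ge0 `|w|; lra.
have t0 : 0 < t by exact: divr_gt0.
have te : t * (`|w| ^+ 2 + 1) = e by rewrite /t mulfVK // gt_eqF.
have te0 : 0 < t * e by exact: mulr_gt0.
pose d := Num.min 1 (t * e / (2 * (2 * m + 1))).
have q0 : 0 < 2 * (2 * m + 1) by lra.
have d0 : 0 < d by rewrite lt_min ltr01 /= divr_gt0.
have d1 : d <= 1 by rewrite ge_min lexx.
have d2 : d * (2 * (2 * m + 1)) <= t * e.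
  by rewrite -ler_pdivlMr // ge_min lexx orbT.
pose s := m ^+ 2 - t * e / 2.
have hs : \forall n \near within A \oo, `|x n - (z + t *: w)| ^+ 2 <= s.
  have hzA : \forall n \near within A \oo, `|x n - z| <= m + d.
    by apply: sub; exact: hz.1.
  have hA : \forall n \near within A \oo, e < ip (x n - z) w by exact: withinT.
  near=> n.
  have h1 : `|x n - z| ^+ 2 <= (m + d) ^+ 2.
    by rewrite ler_pXn2r ?nnegrE ?addr_ge0 ?(ltW d0) //; near: n.
  have h2 : e < ip (x n - z) w by near: n.
  have h5 : (m + d) ^+ 2 <= m ^+ 2 + t * e / 2 by nra.
  move: h1 h2; rewrite opprD addrA; move: (x n - z) => u h1 h2.
  rewrite -(ipxx Hip) !(ipE Hip) (ipC Hip w) !(ipxx Hip).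
  have h3 : t * e < t * ip u w by rewrite ltr_pM2l.
  have h4 : t * (t * `|w| ^+ 2) <= t * e by rewrite ler_pM2l // -te; lra.
  rewrite /s; lra.
have s0 : 0 <= s by have [n] := filter_ex hs; apply: le_trans; exact: exprn_ge0.
have : m' <= Num.sqrt s.
  apply: (hz'.2 (z + t *: w)); apply: filterS hs => n hn.
  by rewrite -(ger0_norm (normr_ge0 _)) -sqrtr_sqr ler_wsqrtr.
apply/negP; rewrite -ltNge; apply: lt_le_trans mm'.
rewrite -(@ltr_pXn2r _ 2) ?nnegrE ?sqrtr_ge0 // sqr_sqrtr // /s; lra.
Unshelve. all: by end_near. Qed.

End KrasnoselskiiMann.

(** * Averagedness criterion and combined cocoercivity inequalities *)

Section CocoerciveEstimates.
Context {R : realType} {V : normedModType R} {ip : V -> V -> R}.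
Hypothesis Hip : is_inner_product ip.

(** Solving the definition for [N] gives [x - th^-1 (x - T x)]; after expansion its nonexpansiveness
    is the hypothesis multiplied by [th^-1]. *)
Lemma averaged_of_residual_ineq (th : R) (T : V -> V) : 0 < th < 1 ->
  (forall x y, `|T x - T y| ^+ 2 + (th^-1 - 1) * `|(x - T x) - (y - T y)| ^+ 2
               <= `|x - y| ^+ 2) ->
  averaged th T.
Proof.
move=> th01 HT; split=> //; have /andP[th0 th1] := th01.
have thn0 : th != 0 by rewrite gt_eqF.
exists (fun x => x - th^-1 *: (x - T x)); split; last first.
  move=> x; rewrite scalerBr scalerA divff // scale1r opprB.
  by rewrite scalerBl scale1r addrA subrK addrC subrK.
move=> x y; rewrite -(@ler_pXn2r _ 2) ?nnegrE //.
move: (HT x y).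
have -> : T x - T y = (x - y) - ((x - T x) - (y - T y)).
  by rewrite opprB addrA subrKA opprB addrC subrKA.
have -> : x - th^-1 *: (x - T x) - (y - th^-1 *: (y - T y)) =
    (x - y) - th^-1 *: ((x - T x) - (y - T y)).
  by rewrite (scalerBr _ (x - T x)) opprD addrACA -opprD.
move: (x - y) (x - T x - (y - T y)) => d r.
rewrite -!(ipxx Hip) !(ipE Hip) (ipC Hip r d) => h.
have : th^-1 * (th^-1 * ip r r - 2 * ip d r) <= 0.
  by rewrite pmulr_rle0 ?invr_gt0 //; lra.
lra.
Qed.

Context {s1 s2 s3 nu lam delta : R}.
Hypotheses (s3_gt0 : 0 < s3) (delta_gt0 : 0 < delta) (nu_gt0 : 0 < nu).

(* Completing the square in [c] trades the term [delta <c, b>], which has no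
   sign, for a multiple of [|a - b|^2]. *)
Lemma cocoercive_triple_ineq (d a b c : V) :
  s1 * `|a| ^+ 2 <= ip d a ->
  s2 * `|b| ^+ 2 <= ip (- (nu *: d) + lam *: a - delta *: c) b ->
  s3 * `|c| ^+ 2 <= ip a c ->
  nu * s1 * `|a| ^+ 2 + s2 * `|b| ^+ 2 - lam * ip a b
    - delta / (4 * s3) * `|a - b| ^+ 2
    + delta * s3 * `|c - (2 * s3)^-1 *: (a - b)| ^+ 2 <= nu * ip d (a - b).
Proof.
move=> h1 h2 h3.
have h1' : nu * (s1 * `|a| ^+ 2) <= nu * ip d a by rewrite ler_pM2l.
have h3' : delta * (s3 * `|c| ^+ 2) <= delta * ip a c by rewrite ler_pM2l.
have s3n0 : s3 != 0 by rewrite gt_eqF.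
have -> : `|c - (2 * s3)^-1 *: (a - b)| ^+ 2 = `|c| ^+ 2
    - s3^-1 * (ip a c - ip c b) + (2 * s3)^-1 ^+ 2 * `|a - b| ^+ 2.
  by rewrite -!(ipxx Hip) !(ipE Hip) (ipC Hip c a) (ipC Hip b c) (ipC Hip b a); field.
move: (`|a - b| ^+ 2) => q.
have -> : delta * s3 * (`|c| ^+ 2 - s3^-1 * (ip a c - ip c b) + (2 * s3)^-1 ^+ 2 * q)
   = delta * (s3 * `|c| ^+ 2) - delta * (ip a c - ip c b) + delta / (4 * s3) * q.
  by field.
move: h2; rewrite !(ipE Hip); lra.
Qed.

(** Here [nu s1 = s2 = lam/2], so the first three terms of [cocoercive_triple_ineq] form exactly
    [(lam/2) |a - b|^2]. *)
Lemma cocoercive_triple_ineq_a (d a b c : V) :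
  s1 * `|a| ^+ 2 <= ip d a ->
  s2 * `|b| ^+ 2 <= ip (- (nu *: d) + lam *: a - delta *: c) b ->
  s3 * `|c| ^+ 2 <= ip a c ->
  lam = 2 * nu * s1 -> lam = 2 * s2 ->
  nu * (nu^-1 * (lam - delta / (2 * s3))) / 2 * `|a - b| ^+ 2
    + delta * s3 * `|c - (2 * s3)^-1 *: (a - b)| ^+ 2 <= nu * ip d (a - b).
Proof.
move=> h1 h2 h3 e1 e2; apply: le_trans (cocoercive_triple_ineq h1 h2 h3).
rewrite lerD2r le_eqVlt; apply/orP; left; apply/eqP.
have -> : nu * s1 = lam / 2 by lra.
have -> : s2 = lam / 2 by lra.
rewrite -!(ipxx Hip) !(ipE Hip) (ipC Hip b a).
by field; rewrite !gt_eqF.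
Qed.

(** With [p = nu s1 - lam/2] and [q = s2 - lam/2], [p |a|^2 + q |b|^2 = (p q |a - b|^2 + |p a + q
    b|^2) / (p + q)]; the [p q] term produces the fraction in the constant. *)
Lemma cocoercive_triple_ineq_b (d a b c : V) :
  s1 * `|a| ^+ 2 <= ip d a ->
  s2 * `|b| ^+ 2 <= ip (- (nu *: d) + lam *: a - delta *: c) b ->
  s3 * `|c| ^+ 2 <= ip a c ->
  lam < nu * s1 + s2 ->
  nu * (nu^-1 * ((2 * nu * s1 - lam) * (2 * s2 - lam)
                               / (2 * (nu * s1 + s2 - lam))
                             + lam - delta / (2 * s3))) / 2 * `|a - b| ^+ 2
    + delta * s3 * `|c - (2 * s3)^-1 *: (a - b)| ^+ 2
    + (nu * s1 + s2 - lam)^-1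
      * `|(nu * s1 - lam / 2) *: a + (s2 - lam / 2) *: b| ^+ 2
  <= nu * ip d (a - b).
Proof.
move=> h1 h2 h3 hl; apply: le_trans (cocoercive_triple_ineq h1 h2 h3).
rewrite addrAC lerD2r le_eqVlt; apply/orP; left; apply/eqP.
rewrite -!(ipxx Hip) !(ipE Hip) (ipC Hip b a).
by field; rewrite !gt_eqF //= subr_gt0.
Qed.

Lemma cvg0_of_norm_sqr_le (k : R) (u : nat -> V) (f : nat -> R) : 0 < k ->
  (forall n, k * `|u n| ^+ 2 <= f n) -> f @ \oo --> (0 : R) -> u @ \oo --> (0 : V).
Proof.
move=> k0 uf /cvgrPdist_le f0; apply/cvgrPdist_le => e e0.
have ke0 : 0 < k * e ^+ 2 by rewrite mulr_gt0 ?exprn_gt0.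
apply: filterS (f0 _ ke0) => n; rewrite !sub0r !normrN => hn.
rewrite -(@ler_pXn2r _ 2) ?nnegrE ?(ltW e0) // -(ler_pM2l k0).
by apply: le_trans (uf n) (le_trans (ler_norm _) hn).
Qed.

Lemma ip_cvg0_of_bounded (M : R) (d u : nat -> V) :
  (forall n, `|d n| <= M) -> u @ \oo --> (0 : V) ->
  (fun n => ip (d n) (u n)) @ \oo --> (0 : R).
Proof.
move=> dM u0; have M0 : 0 <= M by apply: le_trans (dM 0%N).
have Mu0 : (fun n => M * `|u n|) @ \oo --> (0 : R).
  by rewrite -(mulr0 M) -(normr0 V); apply: cvgMr; apply: cvg_norm.
apply: norm_cvg0; apply: (squeeze_cvgr _ (cvg_cst _) Mu0); near=> n.
by rewrite normr_ge0 /= (le_trans (norm_ip_le Hip _ _)) // ler_wpM2r.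
Unshelve. all: by end_near. Qed.

End CocoerciveEstimates.

(** * Weak limit of [T2 (S (x n))] in case (a) *)

Section WeakLimit.
Context {R : realType} {V : normedModType R} {ip : V -> V -> R}.
Hypothesis Hip : is_inner_product ip.
(** In the application [d], [a], [b], [c] are differences between [x n] and a fixed point [z], and
    [B w] is [T2 (S z + w) - T2 (S z)]. *)
Context {s1 s2 nu lam delta : R} {d a b c : nat -> V} {B : V -> V}.
Hypotheses (s2_gt0 : 0 < s2) (nu_gt0 : 0 < nu).
Hypotheses (lam1 : lam = 2 * nu * s1) (lam2 : lam = 2 * s2).
Hypothesis Ha : forall n, s1 * `|a n| ^+ 2 <= ip (d n) (a n).
Hypothesis Hb : forall n w, s2 * `|b n - B w| ^+ 2 <=
  ip (- (nu *: d n) + lam *: a n - delta *: c n - w) (b n - B w).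
Hypothesis HB : forall w, s2 * `|B w| ^+ 2 <= ip w (B w).
Context {Md Mb : R}.
Hypotheses (dM : forall n, `|d n| <= Md) (bM : forall n, `|b n| <= Mb).
Hypothesis d_weak : forall w, (fun n => ip (d n) w) @ \oo --> (0 : R).
Hypothesis ab0 : (fun n => a n - b n) @ \oo --> (0 : V).
Hypothesis c0 : c @ \oo --> (0 : V).

(** Collects the terms that vanish as [n] grows with [w] fixed. *)
Let err w n := nu * ip (d n) (a n - b n) - lam / 2 * `|a n - b n| ^+ 2
  - delta * ip (b n) (c n) + nu * ip (d n) (B w) - lam * ip (B w) (a n - b n)
  + delta * ip (B w) (c n).

(* Adding both cocoercivity inequalities, the quadratic terms combine into
   [|a n - b n|^2] because [nu * s1 = s2 = lam / 2], and the terms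
   [lam <a n, B w>] and [2 s2 <b n, B w>] cancel up to [a n - b n]. *)
Let pairing_le w n : ip (b n) w <= ip w (B w) + err w n.
Proof.
have Ha' : nu * (s1 * `|a n| ^+ 2) <= nu * ip (d n) (a n) by rewrite ler_pM2l.
have Bw0 : 0 <= s2 * `|B w| ^+ 2 by rewrite mulr_ge0 ?sqr_ge0 // ltW.
have := Hb n w; move: Ha' Bw0; rewrite /err.
have -> : nu * (s1 * `|a n| ^+ 2) = lam / 2 * `|a n| ^+ 2.
  by rewrite lam1; field.
have -> : s2 = lam / 2 by rewrite lam2; field.
rewrite -!(ipxx Hip) !(ipE Hip).
rewrite (ipC Hip w) (ipC Hip (a n) (b n)) (ipC Hip (B w) (a n)).
rewrite (ipC Hip (B w) (b n)) (ipC Hip (c n)) (ipC Hip (B w) (c n)).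
lra.
Qed.

Let err_cvg0 w : err w @ \oo --> (0 : R).
Proof.
have -> : (0 : R) = nu * 0 - lam / 2 * 0 ^+ 2 - delta * 0 + nu * 0 - lam * 0 + delta * 0.
  by rewrite expr0n !mulr0 !subr0 !addr0.
have nab0 : (fun n => `|a n - b n|) @ \oo --> (0 : R).
  by rewrite -(normr0 V); exact: cvg_norm.
apply: cvgD; [apply: cvgB; [apply: cvgD; [apply: cvgB; [apply: cvgB|]|]|]|].
- by apply: cvgMr; exact: ip_cvg0_of_bounded dM ab0.
- by apply: cvgMr; rewrite expr2; under eq_fun do rewrite expr2; exact: cvgM.
- by apply: cvgMr; exact: ip_cvg0_of_bounded bM c0.
- by apply: cvgMr; exact: d_weak.
- by apply: cvgMr; exact: (ip_cvg0_of_bounded Hip (fun=> lexx `|B w|) ab0).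
- by apply: cvgMr; exact: (ip_cvg0_of_bounded Hip (fun=> lexx `|B w|) c0).
Qed.

(** Cocoercivity gives [B] linear growth, so this pairing is of second order in [w], negligible
    against [ip (b n) w] for small [w]. *)
Let ip_B_le w : s2 * ip w (B w) <= `|w| ^+ 2.
Proof.
have h := ip_le_norm Hip w (B w).
have := norm_le_of_cocoercive Hip (HB w).
move=> /(ler_wpM2l (normr_ge0 w)); rewrite -expr2; apply: le_trans.
by rewrite mulrCA ler_pM2l.
Qed.

Lemma paired_weak_cvg0 w : (fun n => ip (b n) w) @ \oo --> (0 : R).
Proof.
suff main v e : 0 < e -> \forall n \near \oo, ip (b n) v <= e.
  apply/cvgrPdist_le => e e0; near=> n.
  have h1 : ip (b n) w <= e by near: n; exact: main.
  have h2 : ip (b n) (- w) <= e by near: n; exact: main.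
  by move: h1 h2; rewrite (ipNr Hip) sub0r normrN ler_norml; lra.
move=> e0.
have v1 : 0 < `|v| ^+ 2 + 1 by have := sqr_ge0 `|v|; lra.
(* Chosen so that [t^2 |v|^2 / s2 <= t e / 2]; the other half of [t e] absorbs [err]. *)
pose t := e * s2 / (2 * (`|v| ^+ 2 + 1)).
have t0 : 0 < t by rewrite divr_gt0 ?mulr_gt0.
have te : t * (2 * (`|v| ^+ 2 + 1)) = e * s2 by rewrite mulfVK // gt_eqF // mulr_gt0.
have te0 : 0 < t * e / 2 by rewrite divr_gt0 ?mulr_gt0.
have /cvgrPdist_le/(_ _ te0) := err_cvg0 (t *: v).
apply: filterS => n; rewrite sub0r normrN => /(le_trans (ler_norm _)) hn.
have := pairing_le (t *: v) n; rewrite (ipZr Hip) => h.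
rewrite -(ler_pM2l t0); apply: le_trans h _.
suff : ip (t *: v) (B (t *: v)) <= t * e / 2 by lra.
rewrite -(ler_pM2l s2_gt0); apply: le_trans (ip_B_le _) _.
rewrite normrZ (gtr0_norm t0) exprMn expr2 -mulrA.
have {}te : t * (`|v| ^+ 2 + 1) = e * s2 / 2 by lra.
have -> : s2 * (t * e / 2) = t * (t * (`|v| ^+ 2 + 1)) by rewrite te; field.
by rewrite !ler_pM2l //; lra.
Unshelve. all: by end_near. Qed.

End WeakLimit.

(* The algebraic identity behind this lemma is
   [|d - eta r|^2 + (es/eta - 1) |eta r|^2 = |d|^2 - 2 eta <d, r> + es eta |r|^2]. *)
Lemma residual_ineq_of_cocoercive_difference (R : realType) (V : normedModType R)
  (ip : V -> V -> R) (Hip : is_inner_product ip) (eta es : R) (G T : V -> V) :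
  0 < eta -> 0 < es -> (forall x, T x = x - eta *: G x) ->
  (forall x y, es / 2 * `|G x - G y| ^+ 2 <= ip (x - y) (G x - G y)) ->
  forall x y, `|T x - T y| ^+ 2
      + ((eta / es)^-1 - 1) * `|(x - T x) - (y - T y)| ^+ 2 <= `|x - y| ^+ 2.
Proof.
move=> eta0 es0 HT HG x y.
have res w : w - T w = eta *: G w by rewrite HT opprB addrC subrK.
have -> : T x - T y = (x - y) - eta *: (G x - G y).
  by rewrite !HT opprD addrACA -opprD -scalerBr.
rewrite !res -scalerBr.
move: (HG x y); move: (x - y) (G x - G y) => d r.
rewrite -!(ipxx Hip) !(ipE Hip) (ipC Hip r d) => h.
have -> : (eta / es)^-1 - 1 = es / eta - 1 by rewrite invf_div.
have -> : (es / eta - 1) * (eta * (eta * ip r r)) =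
    eta * (es * ip r r) - eta * (eta * ip r r) by field; rewrite gt_eqF.
have : eta * (es / 2 * ip r r) <= eta * ip d r by rewrite ler_pM2l.
lra.
Qed.

(** * Averagedness of [T] and limits along its orbit *)

Theorem theorem3p3 (R : realType) (X : completeNormedModType R)
  (ip : X -> X -> R) (Hip : is_inner_product ip)
  (T1 T2 T3 : X -> X) (s1 s2 s3 : R)
  (Hs1 : 0 < s1) (Hs2 : 0 < s2) (Hs3 : 0 < s3)
  (HT1 : cocoercive ip s1 T1) (HT2 : cocoercive ip s2 T2)
  (HT3 : cocoercive ip s3 T3)
  (eta nu lam delta : R)
  (Heta : 0 < eta) (Hnu : 0 < nu) (Hlam : 0 < lam) (Hdelta : 0 < delta)
  (S T : X -> X)
  (HS : forall x, S x = - (nu *: x) + lam *: T1 x - delta *: T3 (T1 x))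
  (HT : forall x, T x = x - eta *: T1 x + eta *: T2 (S x))
  (HFix : Fix T !=set0)
  (eta_a eta_b : R)
  (Heta_a : eta_a = nu^-1 * (lam - delta / (2 * s3)))
  (Heta_b : eta_b = nu^-1 * ((2 * nu * s1 - lam) * (2 * s2 - lam)
                               / (2 * (nu * s1 + s2 - lam))
                             + lam - delta / (2 * s3)))
  (Hcase : [/\ lam = 2 * nu * s1, lam = 2 * s2 & eta < eta_a]
           \/ (lam < nu * s1 + s2 /\ eta < eta_b))
  (x0 : X) :
  let x := fun n : nat => iter n T x0 in
  (* (i) *)
  ([/\ lam = 2 * nu * s1, lam = 2 * s2 & eta < eta_a] -> averaged (eta / eta_a) T) /\
  ((lam < nu * s1 + s2 /\ eta < eta_b) -> averaged (eta / eta_b) T) /\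
  exists xstar : X,
    [/\ Fix T xstar,
        weak_cvg ip x xstar &
        (fun n : nat => Num.sqrt (n%:R : R) * `|x n - T (x n)|) @ \oo --> (0 : R)] /\
    (* (ii) *)
    [/\ (fun n => T3 (T1 (x n))) @ \oo --> T3 (T1 xstar),
        (fun z => T3 (T1 z)) @` Fix T = [set T3 (T1 xstar)],
    (* (iii) *)
        ([/\ lam = 2 * nu * s1, lam = 2 * s2 & eta < eta_a] -> nu = lam - 1 ->
           [/\ weak_cvg ip (fun n => T1 (x n)) (T1 xstar),
               weak_cvg ip (fun n => T2 (S (x n))) (T1 xstar) &
               T1 xstar = T2 (S xstar)]) &
    (* (iv) *)
        ((lam < nu * s1 + s2 /\ eta < eta_b) ->
           [/\ (fun n => T1 (x n)) @ \oo --> T1 xstar,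
               (fun n => T2 (S (x n))) @ \oo --> T1 xstar,
               T1 xstar = T2 (S xstar),
               T1 @` Fix T = [set T1 xstar] &
               (fun z => T2 (S z)) @` Fix T = [set T1 xstar]])].
Proof.
move=> x.
have TG y : T y = y - eta *: (T1 y - T2 (S y)).
  by rewrite HT scalerBr opprB addrA addrAC.
have hG y w : T1 y - T2 (S y) - (T1 w - T2 (S w)) =
    T1 y - T1 w - (T2 (S y) - T2 (S w)) by rewrite opprD addrACA -opprD.
(* The shift [q] perturbs the second test point of [T2]: [q = 0] serves the main estimates, general
   [q] the weak limit in (iii). *)
have Hb y w q : s2 * `|T2 (S y) - T2 (S w) - (T2 (S w + q) - T2 (S w))| ^+ 2 <=
    ip (- (nu *: (y - w)) + lam *: (T1 y - T1 w) - delta *: (T3 (T1 y) - T3 (T1 w)) - q)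
       (T2 (S y) - T2 (S w) - (T2 (S w + q) - T2 (S w))).
  have -> : T2 (S y) - T2 (S w) - (T2 (S w + q) - T2 (S w)) = T2 (S y) - T2 (S w + q).
    by rewrite opprB addrA subrK.
  have -> : - (nu *: (y - w)) + lam *: (T1 y - T1 w)
      - delta *: (T3 (T1 y) - T3 (T1 w)) - q = S y - (S w + q).
    rewrite !HS (opprD _ q) addrA (opprD _ (- (delta *: _))) [in RHS]addrACA.
    rewrite (opprD (- (nu *: w))) (addrACA (- (nu *: y))).
    by rewrite -!opprD -!scalerBr.
  exact: HT2.
have Hb0 y w : s2 * `|T2 (S y) - T2 (S w)| ^+ 2 <=
    ip (- (nu *: (y - w)) + lam *: (T1 y - T1 w) - delta *: (T3 (T1 y) - T3 (T1 w)))
       (T2 (S y) - T2 (S w)).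
  by have := Hb y w 0; rewrite addr0 subrr !subr0.
(* The estimate common to both cases, with [e] the bound on the step size, so that averagedness and
   (ii) are derived once. *)
pose key e := forall y w,
    nu * e / 2 * `|T1 y - T1 w - (T2 (S y) - T2 (S w))| ^+ 2
    + delta * s3 * `|T3 (T1 y) - T3 (T1 w)
        - (2 * s3)^-1 *: (T1 y - T1 w - (T2 (S y) - T2 (S w)))| ^+ 2
    <= nu * ip (y - w) (T1 y - T1 w - (T2 (S y) - T2 (S w))).
have key_a : lam = 2 * nu * s1 -> lam = 2 * s2 -> key eta_a.
  move=> e1 e2 y w; rewrite Heta_a.
  exact: (cocoercive_triple_ineq_a Hip Hs3 Hdelta Hnu (HT1 y w) (Hb0 y w) (HT3 _ _)).
have key_b_lin : lam < nu * s1 + s2 -> forall y w,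
    nu * eta_b / 2 * `|T1 y - T1 w - (T2 (S y) - T2 (S w))| ^+ 2
    + delta * s3 * `|T3 (T1 y) - T3 (T1 w)
        - (2 * s3)^-1 *: (T1 y - T1 w - (T2 (S y) - T2 (S w)))| ^+ 2
    + (nu * s1 + s2 - lam)^-1
      * `|(nu * s1 - lam / 2) *: (T1 y - T1 w) + (s2 - lam / 2) *: (T2 (S y) - T2 (S w))| ^+ 2
    <= nu * ip (y - w) (T1 y - T1 w - (T2 (S y) - T2 (S w))).
  move=> hl y w; rewrite Heta_b.
  exact: (cocoercive_triple_ineq_b Hip Hs3 Hdelta Hnu (HT1 y w) (Hb0 y w) (HT3 _ _)).
have key_b : lam < nu * s1 + s2 -> key eta_b.
  move=> hl y w; apply: le_trans (key_b_lin hl y w); rewrite lerDl.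
  by rewrite mulr_ge0 ?sqr_ge0 // invr_ge0 subr_ge0 ltW.
have ds3 : 0 < delta * s3 by exact: mulr_gt0.
have km es : eta < es -> key es ->
    [/\ 0 < eta / es < 1 & forall y w, `|T y - T w| ^+ 2
      + ((eta / es)^-1 - 1) * `|(y - T y) - (w - T w)| ^+ 2 <= `|y - w| ^+ 2].
  move=> hes hk; have es0 : 0 < es by exact: lt_trans hes.
  split; first by rewrite divr_gt0 //= ltr_pdivrMr // mul1r.
  apply: (residual_ineq_of_cocoercive_difference Hip Heta es0 TG) => y w.
  rewrite hG -(ler_pM2l Hnu); apply: le_trans (hk y w).
  rewrite (mulrA nu (es / 2)) (mulrA nu es).
  by rewrite lerDl mulr_ge0 ?sqr_ge0 // ltW.
have [es [hes key_es]] : exists es, eta < es /\ key es.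
  have [[e1 e2 h]|[hl h]] := Hcase; first by exists eta_a; split; [|exact: key_a].
  by exists eta_b; split; [|exact: key_b].
have [/andP[th0 th1] resT] := km _ hes key_es.
have k0 : 0 < (eta / es)^-1 - 1 by rewrite subr_gt0 invf_gt1.
have [z [Tz xz]] := km_weak_cvg Hip k0 resT (x0 := x0) HFix.
(* Fixed points of [T] are zeros of [T1 - T2 S], so [a - b] vanishes on pairs of them. *)
have G0 w : Fix T w -> T1 w - T2 (S w) = 0.
  move=> Tw; apply: (scalerI (lt0r_neq0 Heta)); rewrite scaler0.
  by have := TG w; rewrite [T w]Tw => /eqP; rewrite -subr_eq0 opprB addrC subrK => /eqP.
have TF w : Fix T w -> T1 w = T2 (S w) by move=> /G0/subr0_eq.
split; [move=> [e1 e2 h]|split; [move=> [hl h]|]].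
- have [th H] := km _ h (key_a e1 e2).
  exact (averaged_of_residual_ineq Hip th H).
- have [th H] := km _ h (key_b hl).
  exact (averaged_of_residual_ineq Hip th H).
exists z; split.
  split=> //; exact (km_rate k0 resT (x0 := x0) HFix).
have es0 : 0 < es by exact: lt_trans hes.
pose M := `|x0 - z|.
have xM n : `|x n - z| <= M by exact (km_fejer k0 resT (x0 := x0) Tz (leq0n n)).
pose ab n := T1 (x n) - T1 z - (T2 (S (x n)) - T2 (S z)).
have ab_res n : ab n = eta^-1 *: (x n - T (x n)).
  rewrite TG opprB addrC subrK scalerA mulVf ?gt_eqF // scale1r.
  by rewrite /ab -hG (G0 _ Tz) subr0.
have ab0 : ab @ \oo --> (0 : X).
  rewrite (_ : ab = fun n => eta^-1 *: (x n - T (x n))); last exact/funext.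
  rewrite -(scaler0 _ eta^-1); apply: cvgZr; apply: norm_cvg0.
  exact (km_residual_cvg0 k0 resT (x0 := x0) HFix).
have dab0 : (fun n => nu * ip (x n - z) (ab n)) @ \oo --> (0 : R).
  by rewrite -(mulr0 nu); apply: cvgMr; exact (ip_cvg0_of_bounded Hip xM ab0).
have esab y w : 0 <= nu * es / 2 * `|T1 y - T1 w - (T2 (S y) - T2 (S w))| ^+ 2.
  by rewrite mulr_ge0 ?sqr_ge0 // divr_ge0 // mulr_ge0 // ltW.
have c0 : (fun n => T3 (T1 (x n)) - T3 (T1 z)) @ \oo --> (0 : X).
  have h : (fun n => T3 (T1 (x n)) - T3 (T1 z) - (2 * s3)^-1 *: ab n) @ \oo --> (0 : X).
    apply: (cvg0_of_norm_sqr_le ds3 _ dab0) => n.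
    by apply: le_trans (key_es (x n) z); rewrite lerDr.
  rewrite -(addr0 0) -[X in _ + X](scaler0 _ (2 * s3)^-1).
  rewrite (_ : (fun n => _) = (fun n => (T3 (T1 (x n)) - T3 (T1 z) - (2 * s3)^-1 *: ab n)
     + (2 * s3)^-1 *: ab n)); last by apply/funext => n; rewrite subrK.
  by apply: cvgD h _; exact: cvgZr.
split.
- exact/subr_cvg0.
- apply/seteqP; split=> [_ [w Tw <-]|_ ->]; last by exists z.
  (* For two fixed points [a - b = 0], and [key_es] collapses to [delta s3 |c|^2 <= 0]. *)
  have := key_es w z; rewrite -hG (G0 _ Tz) (G0 _ Tw) !subr0 normr0 expr0n mulr0 add0r.
  rewrite scaler0 subr0 (ip0r Hip) mulr0 pmulr_rle0 // => h.
  by apply/eqP; rewrite -subr_eq0 -normr_le0 -(@ler_pXn2r _ 2) ?nnegrE // expr0n.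
- move=> [e1 e2 h] _.
  have aM n : `|T1 (x n) - T1 z| <= s1^-1 * M.
    rewrite -(ler_pM2l Hs1) mulVKf ?gt_eqF //.
    exact: le_trans (norm_le_of_cocoercive Hip (HT1 _ _)) (xM n).
  (* Uses [b = a - ab], where [key_es] makes [T1 - T2 S] Lipschitz with constant [2 / es]. *)
  have bM n : `|T2 (S (x n)) - T2 (S z)| <= s1^-1 * M + (es / 2)^-1 * M.
    have es20 : 0 < es / 2 by rewrite divr_gt0.
    have -> : T2 (S (x n)) - T2 (S z) = T1 (x n) - T1 z - ab n.
      by rewrite /ab opprB [RHS]addrC subrK.
    apply: le_trans (ler_normB _ _) (lerD (aM n) _).
    rewrite -(ler_pM2l es20) mulVKf ?gt_eqF //; apply: le_trans (xM n).
    apply: (norm_le_of_cocoercive Hip); rewrite -(ler_pM2l Hnu).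
    apply: le_trans (key_es (x n) z); rewrite (mulrA nu (es / 2)) (mulrA nu es).
    by rewrite lerDl mulr_ge0 ?sqr_ge0 // ltW.
  have HB q : s2 * `|T2 (S z + q) - T2 (S z)| ^+ 2 <= ip q (T2 (S z + q) - T2 (S z)).
    by have := HT2 (S z + q) (S z); rewrite addrAC subrr add0r.
  have d0 w : (fun n => ip (x n - z) w) @ \oo --> (0 : R).
    rewrite (_ : (fun n => _) = fun n => ip (x n) w - ip z w).
      by apply/subr_cvg0; exact: xz.
    by apply/funext => n; rewrite !(ipE Hip).
  have b0 w : (fun n => ip (T2 (S (x n)) - T2 (S z)) w) @ \oo --> (0 : R).
    exact (paired_weak_cvg0 Hip Hs2 Hnu e1 e2 (fun n => HT1 (x n) z)
             (fun n => Hb (x n) z) HB xM bM d0 ab0 c0 w).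
  split; last exact: TF.
    move=> w; apply/subr_cvg0.
    have ab_w : (fun n => ip w (ab n)) @ \oo --> (0 : R).
      exact (ip_cvg0_of_bounded Hip (d := fun=> w) (fun=> lexx `|w|) ab0).
    rewrite (_ : (fun n => _) =
      fun n => ip (T2 (S (x n)) - T2 (S z)) w + ip w (ab n)); last first.
      apply/funext => n; rewrite /ab (ipC Hip w) -(ipDl Hip) [in RHS]addrC subrK.
      by rewrite !(ipE Hip).
    by rewrite -(addr0 0); exact: cvgD.
  move=> w; apply/subr_cvg0; rewrite TF // (_ : (fun n => _) =
    fun n => ip (T2 (S (x n)) - T2 (S z)) w) //.
  by apply/funext => n; rewrite !(ipE Hip).
- move=> [hl h].
  have g0 : 0 < nu * s1 + s2 - lam by rewrite subr_gt0.
  have i0 : 0 < (nu * s1 + s2 - lam)^-1 by rewrite invr_gt0.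
  have lin_le y w : (nu * s1 + s2 - lam)^-1 * `|(nu * s1 - lam / 2) *: (T1 y - T1 w)
        + (s2 - lam / 2) *: (T2 (S y) - T2 (S w))| ^+ 2
      <= nu * ip (y - w) (T1 y - T1 w - (T2 (S y) - T2 (S w))).
    have eb0 : 0 < eta_b by exact: lt_trans h.
    apply: le_trans (key_b_lin hl y w); rewrite lerDr addr_ge0 // mulr_ge0 ?sqr_ge0 //.
      by rewrite divr_ge0 // mulr_ge0 // ltW.
    exact: ltW.
  (* [p a + q b + q (a - b) = (p + q) a]: the extra square of case (b), together with [a - b],
     controls [a] itself. *)
  have linE y w : T1 y - T1 w = (nu * s1 + s2 - lam)^-1 *:
      ((nu * s1 - lam / 2) *: (T1 y - T1 w) + (s2 - lam / 2) *: (T2 (S y) - T2 (S w))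
       + (s2 - lam / 2) *: (T1 y - T1 w - (T2 (S y) - T2 (S w)))).
    move: (T1 y - T1 w) (T2 _ - _) => a b.
    rewrite -[_ *: a + _ + _]addrA -scalerDr [b + _]addrC subrK -scalerDl scalerA.
    by rewrite (_ : _ * _ = 1) ?scale1r //; field; rewrite gt_eqF.
  have lin0 := cvg0_of_norm_sqr_le i0 (fun n => lin_le (x n) z) dab0.
  have a0 : (fun n => T1 (x n) - T1 z) @ \oo --> (0 : X).
    have -> : (fun n => T1 (x n) - T1 z) = _ := funext (fun n => linE (x n) z).
    rewrite -(scaler0 _ (nu * s1 + s2 - lam)^-1); apply: cvgZr.
    have bab0 : (fun n => (s2 - lam / 2) *: ab n) @ \oo --> (0 : X).
      by rewrite -(scaler0 _ (s2 - lam / 2)); exact: cvgZr.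
    by have := cvgD lin0 bab0; rewrite addr0; exact.
  have T1F w : Fix T w -> T1 w = T1 z.
    move=> Tw; apply/subr0_eq; rewrite linE -hG (G0 _ Tz) (G0 _ Tw) subr0 scaler0 addr0.
    have := lin_le w z; rewrite -hG (G0 _ Tz) (G0 _ Tw) subr0 (ip0r Hip) mulr0.
    rewrite pmulr_rle0 // => hw.
    suff -> : (nu * s1 - lam / 2) *: (T1 w - T1 z)
        + (s2 - lam / 2) *: (T2 (S w) - T2 (S z)) = 0 by rewrite scaler0.
    by apply/eqP; rewrite -normr_le0 -(@ler_pXn2r _ 2) ?nnegrE // expr0n.
  split.
  + exact/subr_cvg0.
  + rewrite (_ : (fun n => T2 _) = fun n => T1 (x n) - ab n).
      by rewrite -[X in _ --> X](subr0 (T1 z)); apply: cvgB ab0; exact/subr_cvg0.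
    apply/funext => n; rewrite /ab -hG (G0 _ Tz) subr0 opprB addrC subrK //.
  + exact: TF.
  + apply/seteqP; split=> [_ [w Tw <-]|_ ->]; last by exists z.
    exact: T1F.
  + apply/seteqP; split=> [_ [w Tw <-]|_ ->]; last by exists z => //; rewrite TF.
    by rewrite -TF //; exact: T1F.
Qed.
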